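(* Let $A$ and $B$ be compact metric spaces such that $\dim_H A>\alpha\,\overline{\dim}_B B$ for some $\alpha>0$. Then there exist a compact set $A'\subset A$ and an $\alpha$-Hölder onto map $f\colon A'\to B$.
   Context: $\dim_H$ denotes Hausdorff dimension. For a compact metric space $X$ and $r>0$ let $N(X,r)$ be the minimal number of closed balls of radius $r$ (centered in $X$) that cover $X$; the upper box dimension is $\overline{\dim}_B X=\limsup_{r\to0+}\frac{\log N(X,r)}{\log(1/r)}\in[0,\infty]$ for nonempty $X$ (the dimensions of the empty set are taken to be $0$). For $\alpha>0$, a map $f$ between metric spaces is $\alpha$-Hölder if there is a finite $C$ with $d_Y(f(x),f(z))\le C\,d_X(x,z)^\alpha$ for all $x,z$ in its domain ($\alpha>1$ is allowed). *)

(* Defs.v *)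
From HB Require Import structures.
From mathcomp Require Import all_boot all_order all_algebra.
From mathcomp Require Import all_classical all_reals all_analysis.

Set Implicit Arguments.
Unset Strict Implicit.
Unset Printing Implicit Defensive.

Import Order.TTheory GRing.Theory Num.Theory.
Import numFieldNormedType.Exports.

Local Open Scope classical_set_scope.
Local Open Scope ring_scope.

(* The library only makes [set_type A] a pseudometric space; the restricted
   distance below induces that existing structure. *)
Section subset_metric.
Context {R : realType} {X : metricType R} (A : set X).

Let dist (x y : set_type A) : R := mdist (set_val x) (set_val y).

Let dist_ge0 x y : 0 <= dist x y.
Proof. exact: mdist_ge0. Qed.

Let dist_positivity x y : dist x y = 0 -> x = y.
Proof. by move=> /mdist_positivity; rewrite set_valE => /val_inj. Qed.

Let ball_dist (x : set_type A) (d : R) : ball x d = [set y | dist x y < d].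
Proof. by rewrite -initial_ballE ballEmdist. Qed.

HB.instance Definition _ :=
  PseudoMetric_isMetric.Build R (set_type A) dist_ge0 dist_positivity ball_dist.

End subset_metric.

Section dimensions.
Context {R : realType} (X : metricType R).
Local Open Scope ereal_scope.

(* Adding 0 makes the diameter of the empty set 0 instead of -oo. *)
Definition diam (U : set X) : \bar R :=
  ereal_sup (0 |` [set (mdist x y)%:E | x in U & y in U]).

Definition hausdorff_premeasure (s : R) (delta : R) (E : set X) : \bar R :=
  ereal_inf [set \sum_(0 <= i <oo) diam (U i) `^ s | U in
    [set U : nat -> set X |
      (forall i, diam (U i) <= delta%:E) /\ E `<=` \bigcup_i U i]].

Definition hausdorff_measure (s : R) (E : set X) : \bar R :=
  ereal_sup [set hausdorff_premeasure s delta E | delta in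
    [set delta : R | (0 < delta)%R]].

(* Only s > 0 is used: this does not change the infimum, gives 0 for the empty
   space, and avoids the convention 0 `^ 0 = 1. The value is +oo if no s
   qualifies. *)
Definition hausdorff_dim : \bar R :=
  ereal_inf [set s%:E | s in
    [set s : R | (0 < s)%R /\ hausdorff_measure s [set: X] = 0]].

(* Not the library's [closed_ball], which is the closure of the open ball. *)
Definition closed_mball (x : X) (r : R) : set X :=
  [set y | (mdist x y <= r)%R].

(* +oo if there is no finite cover. *)
Definition covering_number (r : R) : \bar R :=
  ereal_inf [set n%:R%:E | n in
    [set n : nat | exists c : 'I_n -> X,
      [set: X] `<=` \bigcup_i closed_mball (c i) r]].

Definition upper_box_dim : \bar R :=
  if `[< [set: X] = set0 >] then 0 else
  limf_esup (fun r : R => lne (covering_number r) * ((ln r^-1)^-1)%:E) 0^'+.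

End dimensions.

Definition holder {R : realType} (alpha : R) (X Y : metricType R)
    (f : X -> Y) : Prop :=
  exists C : R, forall x z : X, mdist (f x) (f z) <= C * mdist x z `^ alpha.

(* Main.v *)
Require Import Defs.
From HB Require Import structures.
From mathcomp Require Import all_boot all_order all_algebra.
From mathcomp Require Import all_classical all_reals all_analysis.
From mathcomp Require Import ring lra.

Set Implicit Arguments.
Unset Strict Implicit.
Unset Printing Implicit Defensive.

Import Order.TTheory GRing.Theory Num.Theory.
Import numFieldNormedType.Exports.

(* By compactness (Tychonoff) it is enough to find, for every e > 0, a map
   g : B -> A with d(b, b') <= C d(g b, g b')^alpha + e, with C independent of
   e: a limit g of such maps has an alpha-Hoelder inverse on its image, which
   extends to the closure of the image.

   Choose alpha * dim_B B < alpha * u < s < dim_H A and put r_m = ep / 4^m.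
   Rounding B successively at the scales r_m^alpha gives a finite tree with at
   most r_m^(-alpha u) nodes at level m. On a fine finite net of A there is a
   mass mu, bounded below independently of the net, with mu(ball x (2 r_m)) <=
   r_m^s. The tree is embedded level by level, two different nodes of level m
   being sent to sets at distance > r_m / K. With eps = 1 / K the capacity of a
   family of separated sets E at level m is measured by
     sum_E sum_(x in E) mu x * mu(E n ball x r_m)^(-eps),
   and ball growing cuts every E into separated sets of radius about r_(m+1)
   without decreasing the capacity, each piece being responsible for at most
   r_(m+1)^(s (1 - eps)) of it. Since alpha u < s (1 - eps), the pieces can be
   distributed greedily among the nodes of the next level. *)

Local Open Scope ring_scope.

(** * Real powers, a pigeonhole for ratios, and greedy distribution *)

Lemma powRV {R : realType} (x e : R) : 0 <= x -> x^-1 `^ e = (x `^ e)^-1.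
Proof. by move=> x0; rewrite -powR_inv1// -powRrM mulN1r powRN. Qed.

(** Otherwise each of the [K.+1] ratios [a k.+1 / a k] would exceed their geometric mean [c]. *)
Lemma powR_pigeonhole {R : realType} (K : nat) (a : nat -> R) :
  (forall k, 0 < a k) ->
  exists2 k, (k < K.+1)%N &
    a k.+1 * a K.+1 `^ (- K.+1%:R^-1) <= a k * a 0%N `^ (- K.+1%:R^-1).
Proof.
move=> a0; apply/not_exists2P => H.
pose c := (a K.+1 / a 0%N) `^ K.+1%:R^-1.
have c0 : 0 < c by rewrite powR_gt0// divr_gt0.
have aS k : (k < K.+1)%N -> a k * c < a k.+1.
  move=> kK; have [//|/negP] := H k; rewrite -ltNge !powRN ltr_pdivlMr ?powR_gt0//.
  by rewrite mulrAC -mulrA /c powRM ?invr_ge0 ?ltW// powRV ?ltW.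
have ak k : (k <= K)%N -> a 0%N * c ^+ k <= a k.
  elim: k => [_|k IH kK]; first by rewrite expr0 mulr1.
  rewrite exprSr mulrA (le_trans _ (ltW (aS _ _)))// ?ltnS 1?ltnW//.
  by rewrite ler_pM2r// IH// ltnW.
have : a 0%N * c ^+ K.+1 < a K.+1.
  by rewrite exprSr mulrA (le_lt_trans _ (aS _ _))// ler_pM2r// ak.
rewrite -powR_mulrn ?ltW// /c -powRrM. rewrite mulVf ?pnatr_eq0// powRr1 ?ltW ?divr_gt0//.
by rewrite mulrCA mulfV ?gt_eqF// mulr1 ltxx.
Qed.

Lemma ler_powRN {R : realType} (x y e : R) :
  0 <= e -> 0 < x -> x <= y -> y `^ (- e) <= x `^ (- e).
Proof.
move=> e0 x0 xy; have y0 := lt_le_trans x0 xy.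
by rewrite !powRN lef_pV2 ?posrE ?powR_gt0// ge0_ler_powR// nnegrE ltW.
Qed.

(** The shortest prefix whose sum exceeds [t] overshoots by at most its last term. *)
Lemma prefix_sum_gt {R : realType} (X : eqType) (v : X -> R) (c t : R) (L : seq X) :
  0 <= t -> {in L, forall x, v x <= c} -> t < \sum_(x <- L) v x ->
  exists L1 L2, [/\ L = L1 ++ L2, t < \sum_(x <- L1) v x &
                    \sum_(x <- L1) v x <= t + c].
Proof.
elim: L t => [|x L IH] t t0 vc; first by rewrite big_nil ltNge t0.
have vxc : v x <= c by rewrite vc// mem_head.
rewrite big_cons; have [tx _|xt tL] := ltP t (v x).
  by exists [:: x], L; rewrite big_seq1; split => //; rewrite (le_trans vxc)// lerDr.
have tv0 : 0 <= t - v x by rewrite subr_ge0.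
have vL : {in L, forall y, v y <= c} by move=> y yL; rewrite vc// inE yL orbT.
have [|L1 [L2 [-> L1t L1c]]] := IH _ tv0 vL; first by rewrite ltrBlDl.
exists (x :: L1), L2; rewrite big_cons; split => //; first by rewrite -ltrBlDl.
by rewrite -lerBrDl addrAC.
Qed.

(** Each index in turn takes a prefix of what is left, just long enough to exceed [f i]. It uses up
    at most [f i + c], hence the extra [c] per index in the budget. *)
Lemma greedy_split {R : realType} (X I : eqType) (e : rel X) (v : X -> R) (c : R)
    (f : I -> R) (s : seq I) (L : seq X) :
  symmetric e -> (forall i, 0 <= f i) -> 0 <= c -> uniq s -> pairwise e L ->
  {in L, forall x, v x <= c} ->
  \sum_(i <- s) (f i + c) < \sum_(x <- L) v x ->
  exists G : I -> seq X, [/\ forall i, {subset G i <= L},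
    forall i, pairwise e (G i),
    {in s, forall i, f i < \sum_(x <- G i) v x} &
    {in s &, forall i j, i != j -> {in G i & G j, forall x y, e x y}}].
Proof.
move=> eC f0 c0; elim: s L => [|i s IH] L /= us eL vc.
  by move=> _; exists (fun=> [::]).
case/andP: us => is_ us; rewrite big_cons => lt_sum.
have lt_i : f i < \sum_(x <- L) v x.
  apply: le_lt_trans lt_sum; rewrite -addrA lerDl addr_ge0// sumr_ge0// => j _.
  by rewrite addr_ge0.
have [L1 [L2 [EL L1f L1c]]] := prefix_sum_gt (f0 i) vc lt_i.
move: eL; rewrite EL pairwise_cat => /and3P[e12 e1 e2].
have [||G [GL Ge Gf Gsep]] := IH L2 us e2.
- by move=> x xL2; rewrite vc// EL mem_cat xL2 orbT.
- by move: lt_sum; rewrite EL big_cat/=; lra.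
exists (fun j => if j == i then L1 else G j); split.
- move=> j x; rewrite mem_cat; case: ifP => _; first by move->.
  by move/GL ->; rewrite orbT.
- by move=> j; case: ifP.
- move=> j; rewrite inE => /predU1P[->|js]; first by rewrite eqxx.
  by case: eqP => [->//|_]; exact: Gf.
- move=> j k; rewrite !inE; have [->|ji]/= := eqVneq j i.
    move=> _; have [->|ki] := eqVneq k i; first by [].
    by move=> _ _ x y xL1 /GL yL2; exact: (allrelP e12).
  move=> js; have [-> _ _ x y /GL xL2 yL1|ki ks jk x y] := eqVneq k i.
    by rewrite eC; exact: (allrelP e12).
  exact: (Gsep j k).
Qed.

(** * Capacity and ball growing in a finite pseudometric space *)

Section finite_pseudometric.
Context {R : realType} {T : finType} (d : T -> T -> R) (mu : T -> R).
Context (dxx : forall x, d x x = 0) (dC : forall x y, d x y = d y x).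
Context (dD : forall y x z, d x z <= d x y + d y z).
Context (mu_ge0 : forall x, 0 <= mu x).

Definition bmass (E : {set T}) (x : T) (rho : R) : R :=
  \sum_(y in E | d x y <= rho) mu y.

(** The contribution of one set [E] to the capacity. If [E] has positive mass and diameter at most
    [rho], this is its mass to the power [1 - eps]. *)
Definition energy (eps : R) (E : {set T}) (rho : R) : R :=
  \sum_(x in E) mu x * bmass E x rho `^ (- eps).

Definition separated (delta : R) (P Q : {set T}) : bool :=
  [forall x in P, forall y in Q, delta < d x y].

Lemma separatedP delta (P Q : {set T}) :
  reflect {in P & Q, forall x y, delta < d x y} (separated delta P Q).
Proof.
apply: (iffP forall_inP) => [H x y xP yQ|H x xP].
  by have /forall_inP := H x xP; exact.
by apply/forall_inP => y; exact: H.
Qed.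

Lemma separated_sym delta P Q : separated delta P Q = separated delta Q P.
Proof.
by apply/separatedP/separatedP => H x y xP yQ; rewrite dC; exact: H.
Qed.

Lemma separatedS delta delta' (P P' Q Q' : {set T}) : delta' <= delta ->
  P' \subset P -> Q' \subset Q -> separated delta P Q -> separated delta' P' Q'.
Proof.
move=> le_delta /fintype.subsetP sP /fintype.subsetP sQ /separatedP H; apply/separatedP.
by move=> x y /sP xP /sQ yQ; rewrite (le_lt_trans le_delta)// H.
Qed.

Lemma ler_sum_sub (P Q : pred T) : subpred P Q ->
  \sum_(x | P x) mu x <= \sum_(x | Q x) mu x.
Proof.
move=> PQ; rewrite big_mkcond [leRHS]big_mkcond ler_sum// => x _.
by case: ifP => [/PQ ->//|_]; case: ifP.
Qed.

Lemma bmass_gt0 (E : {set T}) x rho :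
  x \in E -> 0 <= rho -> 0 < mu x -> 0 < bmass E x rho.
Proof.
move=> xE rho0 mux; rewrite /bmass (bigD1 x)/= ?xE ?dxx//.
by rewrite ltr_pwDl// sumr_ge0.
Qed.

(* Ball growing: around the point [x0] of [F] whose [r]-ball is heaviest, cut out
   [P = ball x0 (rho k)] and discard the shell up to [Q = ball x0 (rho k.+1)]
   where, by pigeonhole, the shell is light. The value of [P] is what all of [Q]
   contributed to the left-hand sum; unlike [energy eps P r], it is also at most
   a power of the mass of one ball of radius [2 * r]. *)
Lemma carve_rec (K : nat) (r c : R) (E : {set T}) : 0 < r ->
  (forall x, bmass [set: T] x (2 * r) <= c) ->
  let eps : R := K.+1%:R^-1 in
  forall F : {set T}, F \subset E -> exists L : seq ({set T} * R),
  [/\ {in L, forall p : {set T} * R, p.1 \subset F},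
      pairwise (fun p q => separated (r / K.+1%:R) p.1 q.1) L,
      {in L, forall p : {set T} * R, p.2 <= energy eps p.1 r /\ p.2 <= c `^ (1 - eps)} &
      \sum_(x in F) mu x * bmass E x (4 * r) `^ (- eps) <= \sum_(p <- L) p.2].
Proof.
move=> r0 mass_c eps F; have [n] := ubnP #|F|.
have eps0 : 0 < eps by rewrite invr_gt0.
have eps1 : eps <= 1 by rewrite invf_le1// ler1n.
elim: n F => // n IH F Fn FE.
have [/existsP[z /andP[zF muz]]|/existsPn F0] := boolP [exists z in F, 0 < mu z]; last first.
  exists [::]; split => //; rewrite big_nil big1// => x xF.
  suff -> : mu x = 0 by rewrite mul0r.
  by apply/eqP; rewrite eq_le mu_ge0 andbT leNgt; have := F0 x; rewrite xF.
case: (@Order.TotalTheory.arg_maxP _ R T z (mem F) (bmass F ^~ r) zF) => x0 x0F_ x0max.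
have x0F : x0 \in F by [].
(* [K.+1] equal steps lead from [r] to [2 * r]; the step length is the separation to be gained. *)
pose rho (k : nat) := r + k%:R * (r / K.+1%:R).
have rhoS k : rho k.+1 = rho k + r / K.+1%:R.
  by rewrite /rho -natr1 mulrDl mul1r addrA.
have rK0 : 0 < r / K.+1%:R by rewrite divr_gt0.
have rhoK : rho K.+1 = 2 * r.
  by rewrite /rho mulrCA divff ?mulr1 ?pnatr_eq0// -mulr2n mulr_natl.
have rho_le k l : (k <= l)%N -> rho k <= rho l.
  by move=> kl; rewrite /rho lerD2l ler_pM2r// ler_nat.
have rho0 : rho 0%N = r by rewrite /rho mul0r addr0.
pose a k := bmass F x0 (rho k).
have m0 : 0 < bmass F x0 r.
  by rewrite (lt_le_trans _ (x0max z zF))// bmass_gt0// ltW.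
have a_le k l : (k <= l)%N -> a k <= a l.
  move=> kl; apply: ler_sum_sub => y /andP[-> /= h].
  by rewrite (le_trans h)// rho_le.
have a0 k : 0 < a k.
  by rewrite (lt_le_trans _ (a_le 0%N k _))// /a rho0.
have [k kK ak] := powR_pigeonhole K a0.
pose P := [set y in F | d x0 y <= rho k].
pose Q := [set y in F | d x0 y <= rho k.+1].
have [] := IH (F :\: Q).
- apply: leq_trans (ltnSE Fn); apply: proper_card; apply/properP; split.
    exact: finset.subsetDl.
  exists x0 => //; rewrite !inE x0F dxx/= negb_and negbK orbF.
  by rewrite (le_trans _ (rho_le 0%N _ _))// rho0 ltW.
- exact: fintype.subset_trans (finset.subsetDl _ _) FE.
move=> L [LF Lsep Lv Lsum].
pose v := \sum_(y in Q) mu y * bmass E y (4 * r) `^ (- eps).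
(* Points of [Q] are within [2 * r] of [x0], so their [4 * r]-balls contain the [2 * r]-ball of
   [x0], whose part in [F] has mass [a K.+1]. *)
have vle : v <= a k.+1 * a K.+1 `^ (- eps).
  have -> : a k.+1 = \sum_(y in Q) mu y.
    by apply: eq_bigl => y; rewrite !inE.
  rewrite mulr_suml; apply: ler_sum => y; rewrite !inE => /andP[yF yQ].
  rewrite ler_wpM2l// ler_powRN// ?(ltW eps0)//.
  apply: ler_sum_sub => u /andP[uF]; rewrite rhoK => ux0.
  rewrite (fintype.subsetP FE)//= (le_trans (dD x0 _ _))//.
  have -> : 4 * r = 2 * r + 2 * r by ring.
  by rewrite lerD// dC -rhoK (le_trans yQ)// rho_le.
exists ((P, v) :: L); split.
- move=> p; rewrite inE => /orP[/eqP -> /=|pL].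
    by apply/fintype.subsetP => y; rewrite inE => /andP[].
  exact: fintype.subset_trans (LF _ pL) (finset.subsetDl _ _).
- rewrite /= Lsep andbT; apply/allP => p pL /=.
  apply/separatedP => x y; rewrite inE => /andP[xF xP] yp.
  have := fintype.subsetP (LF _ pL) _ yp; rewrite !inE => /andP[/[swap] ->]/=.
  rewrite -ltNge rhoS => h; have := dD x x0 y.
  move: xP h; set w := r / _; lra.
- move=> p; rewrite inE => /orP[/eqP -> /=|]; last exact: Lv.
  split.
    (* The choice of [k] replaces [Q] by [P] and [a K.+1] by [a 0%N]; maximality of [x0] then gives
       [bmass P y r <= a 0%N] for [y] in [P]. *)
    apply: (le_trans vle); apply: (le_trans ak).
    have -> : a k = \sum_(y in P) mu y.
      by apply: eq_bigl => y; rewrite !inE.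
    rewrite mulr_suml; apply: ler_sum => y; rewrite !inE => /andP[yF yP].
    have := mu_ge0 y; rewrite le_eqVlt => /predU1P[<-|muy]; first by rewrite !mul0r.
    rewrite ler_pM2l// ler_powRN// ?(ltW eps0)//.
      by rewrite bmass_gt0 ?inE ?yF// ltW.
    apply: le_trans (_ : bmass F y r <= _).
      by apply: ler_sum_sub => u; rewrite !inE => /andP[/andP[-> _] ->].
    by rewrite /a rho0; exact: x0max.
  have aKc : a K.+1 <= c.
    apply: le_trans (mass_c x0); apply: ler_sum_sub => u.
    by rewrite rhoK inE => /andP[_ ->].
  apply: (le_trans vle); apply: (@le_trans _ _ (a K.+1 `^ (1 - eps))).
    rewrite powRD; last by rewrite (gt_eqF (a0 _)) implybT.
    rewrite powRr1; last exact: ltW.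
    by rewrite ler_wpM2r ?powR_ge0// a_le.
  by rewrite ge0_ler_powR ?subr_ge0// nnegrE ltW// (lt_le_trans _ aKc).
- rewrite big_cons /= (big_setID Q)/= (finset.setIidPr _); last first.
    by apply/fintype.subsetP => y; rewrite inE => /andP[].
  by rewrite lerD2l.
Qed.

(** Each set is carved on its own. Pieces of different sets inherit the separation [4 * r / K.+1],
    which exceeds [r / K.+1]. *)
Lemma carve (K : nat) (r c : R) (s : seq {set T}) : 0 < r ->
  (forall x, bmass [set: T] x (2 * r) <= c) ->
  pairwise (separated (4 * r / K.+1%:R)) s ->
  let eps : R := K.+1%:R^-1 in exists L : seq ({set T} * R),
  [/\ {in L, forall p : {set T} * R, exists2 P, P \in s & p.1 \subset P},
      pairwise (fun p q => separated (r / K.+1%:R) p.1 q.1) L,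
      {in L, forall p : {set T} * R,
        p.2 <= energy eps p.1 r /\ p.2 <= c `^ (1 - eps)} &
      \sum_(P <- s) energy eps P (4 * r) <= \sum_(p <- L) p.2].
Proof.
move=> r0 mass_c + eps; elim: s => [_|P s IH].
  by exists [::]; split => //; rewrite !big_nil.
rewrite pairwise_cons => /andP[/allP Ps /IH[L [Ls Lsep Lv Lsum]]].
have [L' [L'P L'sep L'v L'sum]] := carve_rec K r0 mass_c (fintype.subxx P).
exists (L' ++ L); split.
- move=> p; rewrite mem_cat => /orP[/L'P pP|/Ls[Q Qs pQ]].
    by exists P; rewrite ?mem_head.
  by exists Q; rewrite // inE Qs orbT.
- rewrite pairwise_cat L'sep Lsep !andbT; apply/allrelP => p q pL' /Ls[Q Qs qQ].
  apply: separatedS qQ (Ps _ Qs); last exact: L'P.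
  by rewrite ler_pM2r ?invr_gt0//; move: r0; lra.
- by move=> p; rewrite mem_cat => /orP[/L'v|/Lv].
- by rewrite big_cons big_cat/= lerD.
Qed.

(** * Embedding a finite tree level by level *)

Section tree.
Context (I : nat -> finType) (p : forall n, I n.+1 -> I n).
Context (B : Type) (l : forall n, B -> I n).
Context (r c : nat -> R).

(** The capacity that node [i] of level [n] must exceed to serve [k] more levels. Each child is
    charged its own demand plus [w n.+1], a bound for the greedy overshoot. *)
Fixpoint demand (w : nat -> R) (k n : nat) : I n -> R :=
  if k is k'.+1 then
    fun i => \sum_(j | p j == i) (demand w k' j + w n.+1)
  else fun=> 0.

Lemma demand_ge0 w k n i : (forall n, 0 <= w n) -> 0 <= @demand w k n i.
Proof.
move=> w0; elim: k n i => //= k IH n i.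
by apply: sumr_ge0 => j _; rewrite addr_ge0.
Qed.

Lemma sum_demand w k n :
  \sum_i @demand w k n i =
  \sum_(n.+1 <= m < (n + k).+1) #|I m|%:R * w m.
Proof.
elim: k n => [|k IH] n; first by rewrite addn0 big_geq// big1.
transitivity (\sum_(j : I n.+1) (demand w k j + w n.+1)).
  by rewrite [RHS](partition_big (@p n) xpredT).
rewrite big_split/= IH addSnnS.
rewrite [RHS]big_ltn; last by rewrite ltnS addnS ltnS leq_addr.
by rewrite addrC sumr_const mulr_natl.
Qed.

Lemma energy_gt0 eps s rho : 0 < \sum_(P <- s) energy eps P rho ->
  exists P : {set T}, P \in s /\ exists x, x \in P.
Proof.
move=> sum_gt0; apply: contrapT => noP.
move: sum_gt0; rewrite big_seq big1 ?ltxx// => P Ps.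
by rewrite /energy big1// => x xP; exfalso; apply: noP; exists P; split => //; exists x.
Qed.

(** Induction on the number [k] of levels left, for the subtree below [i]: carving gives pieces at
    scale [r n.+1] without loss of capacity, and greedy splitting hands each child a group of pieces
    whose capacity exceeds its demand. *)
Lemma tree_embedding K k n (i : I n) (s : seq {set T}) :
  let eps : R := K.+1%:R^-1 in
  (forall m, 0 < r m) -> (forall m, r m = 4 * r m.+1) ->
  (forall m, (n <= m < n + k)%N ->
    (forall x, bmass [set: T] x (2 * r m.+1) <= c m.+1)
    /\ forall b, p (l m.+1 b) = l m b) ->
  pairwise (separated (r n / K.+1%:R)) s ->
  demand (fun m => c m `^ (1 - eps)) k i < \sum_(P <- s) energy eps P (r n) ->
  exists g : B -> T,
    (forall b, l n b = i -> exists2 P, P \in s & g b \in P) /\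
    (forall b b', l n b = i -> l n b' = i -> forall m, (n < m <= n + k)%N ->
      l m b <> l m b' -> r m / K.+1%:R < d (g b) (g b')).
Proof.
move=> eps r0 rS; elim: k n i s => [|k IH] n i s H sep_s lt_demand.
  have [P [Ps [x xP]]] := energy_gt0 (le_lt_trans (demand_ge0 _ _ (fun m => powR_ge0 _ _)) lt_demand).
  exists (fun=> x); split; first by move=> b _; exists P.
  by move=> b b' _ _ m; rewrite addn0; case: ltngtP.
have [P0 [P0s [x0 x0P0]]] := energy_gt0 (le_lt_trans (demand_ge0 _ _ (fun m => powR_ge0 _ _)) lt_demand).
move: lt_demand => /=; set w := fun m => c m `^ (1 - eps) => lt_demand.
have [mass_c ln] : (forall x, bmass [set: T] x (2 * r n.+1) <= c n.+1)
    /\ forall b, p (l n.+1 b) = l n b.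
  by apply: H; rewrite leqnn addnS ltnS leq_addr.
move: sep_s; rewrite rS => sep_s.
have [L [Ls Lsep Lv Lsum]] := carve (r0 n.+1) mass_c sep_s.
rewrite rS in lt_demand.
have w0 m : 0 <= w m by exact: powR_ge0.
have d0 m j : 0 <= @demand w k m j by exact: demand_ge0.
have eC : symmetric (fun q q' : {set T} * R => separated (r n.+1 / K.+1%:R) q.1 q'.1).
  by move=> q q'; exact: separated_sym.
have vw : {in L, forall q : {set T} * R, q.2 <= w n.+1} by move=> q /Lv[].
have := @greedy_split _ _ _ _ snd (w n.+1) (@demand w k n.+1)
  (enum [pred j | p j == i]) L eC (@d0 n.+1) (w0 _) (enum_uniq _) Lsep vw.
rewrite big_enum => /(_ (lt_le_trans lt_demand Lsum))[G [GL Gsep Gd Gcross]].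
have /choice[gs gsP] : forall j, exists g : B -> T, p j = i ->
    (forall b, l n.+1 b = j -> exists2 q, q \in G j & g b \in q.1) /\
    (forall b b', l n.+1 b = j -> l n.+1 b' = j -> forall m, (n.+1 < m <= n + k.+1)%N ->
      l m b <> l m b' -> r m / K.+1%:R < d (g b) (g b')).
  move=> j; have [pj|pj] := eqVneq (p j) i; last first.
    by exists (fun=> x0) => e; rewrite e eqxx in pj.
  have [|||g [gG gd]] := IH n.+1 j [seq q.1 | q <- G j].
  - by move=> m /andP[nm mk]; apply: H; rewrite addnS -addSn mk ltnW.
  - by rewrite pairwise_map; exact: Gsep.
  - rewrite big_map; apply: lt_le_trans (Gd j _) _; first by rewrite mem_enum inE pj.
    by rewrite big_seq [leRHS]big_seq; apply: ler_sum => q /GL/Lv[].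
  exists g => _; split; last by move=> *; apply: gd; rewrite // addSnnS.
  by move=> b /gG[P /mapP[q qG ->] gq]; exists q.
exists (fun b => gs (l n.+1 b) b); split.
  move=> b lb; have pb : p (l n.+1 b) = i by rewrite ln.
  have [q qG gq] := (gsP _ pb).1 b erefl.
  by have [P Ps qP] := Ls _ (GL _ _ qG); exists P => //; exact: (fintype.subsetP qP).
move=> b b' lb lb' m /andP[nm mk] lbb'.
have pb : p (l n.+1 b) = i by rewrite ln.
have pb' : p (l n.+1 b') = i by rewrite ln.
(* With the same child the induction applies, since then [m] is not [n.+1]. With different children
   the groups are separated by [r n.+1 / K.+1], and [r] decreases. *)
have [e|ne] := eqVneq (l n.+1 b) (l n.+1 b').
  rewrite -e; apply: ((gsP _ pb).2 b b' _ _ m) => //.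
  rewrite mk andbT ltn_neqAle nm andbT; apply/eqP => em.
  by rewrite -em in lbb'.
have [q qG gq] := (gsP _ pb).1 b erefl.
have [q' qG' gq'] := (gsP _ pb').1 b' erefl.
have := Gcross (l n.+1 b) (l n.+1 b'); rewrite !mem_enum !inE pb pb' eqxx.
move=> /(_ isT isT ne q q' qG qG') /separatedP /(_ _ _ gq gq').
apply: le_lt_trans; rewrite ler_pM2r ?invr_gt0//.
rewrite -(subnKC nm); elim: (m - n.+1)%N => [|u IHu]; first by rewrite addn0.
rewrite addnS; apply: le_trans IHu.
by have := r0 (n.+1 + u).+1; rewrite [leRHS]rS; lra.
Qed.

End tree.

(** No ball outweighs the whole space, and the exponent [- eps] reverses this. *)
Lemma energy_setT_ge (eps rho : R) : 0 <= eps -> 0 <= rho -> 0 < \sum_x mu x ->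
  (\sum_x mu x) `^ (1 - eps) <= energy eps [set: T] rho.
Proof.
move=> eps0 rho0 M0; rewrite powRD; last by rewrite (gt_eqF M0) implybT.
rewrite powRr1; last exact: ltW.
rewrite mulr_suml /energy [leRHS](eq_bigl xpredT); last by move=> x; rewrite inE.
apply: ler_sum => x _; have := mu_ge0 x; rewrite le_eqVlt => /predU1P[<-|mux].
  by rewrite !mul0r.
rewrite ler_pM2l// ler_powRN//; first by rewrite bmass_gt0// inE.
by apply: (@ler_sum_sub _ xpredT).
Qed.

End finite_pseudometric.

(** * A Frostman mass on a finite space *)

Section finite_frostman.
Context {R : realType} {T I : finType} (d : T -> T -> R) (rho w : I -> R).
Context (dxx : forall x, d x x = 0) (dC : forall x y, d x y = d y x).
Context (dD : forall y x z, d x z <= d x y + d y z).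
Context (rho_ge0 : forall i, 0 <= rho i) (w_ge0 : forall i, 0 <= w i).

(** The points of [s] are treated one by one: [mu x] is raised by the least slack among the
    constraints whose ball contains [x]. This makes one of them tight, and constraints already tight
    stay so because masses only grow. *)
Lemma exists_tight_mass (i0 : I) (s : seq T) : exists mu : T -> R,
  [/\ forall x, 0 <= mu x,
      forall x i, bmass d mu [set: T] x (rho i) <= w i &
      {in s, forall x, exists y i, d y x <= rho i /\
        bmass d mu [set: T] y (rho i) = w i}].
Proof.
elim: s => [|x s [mu [mu0 muw tight]]].
  by exists (fun=> 0); split => // x i; rewrite /bmass big1.
have q0P : d (x, i0).1 x <= rho (x, i0).2 by rewrite /= dxx.
pose slack (q : T * I) := w q.2 - bmass d mu [set: T] q.1 (rho q.2).
case: (@Order.TotalTheory.arg_minP _ R (T * I)%type (x, i0)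
  (fun q => d q.1 x <= rho q.2) slack q0P) => -[y i] /= yx yimin.
set t := slack (y, i) in yimin.
have t0 : 0 <= t by rewrite subr_ge0.
pose mu' z := mu z + (if z == x then t else 0).
have mu'E z j : bmass d mu' [set: T] z (rho j) =
    bmass d mu [set: T] z (rho j) + (if d z x <= rho j then t else 0).
  rewrite /bmass big_split/=; congr (_ + _); rewrite -big_mkcondr.
  case: ifP => zx; last first.
    by rewrite big1// => u /andP[/andP[_ zu] /eqP ux]; rewrite -ux zu in zx.
  rewrite (eq_bigl (pred1 x)) ?big_pred1_eq// => u.
  by rewrite inE/=; case: eqP => [->|]; rewrite ?zx ?andbF.
have mu'w z j : bmass d mu' [set: T] z (rho j) <= w j.
  rewrite mu'E; case: ifP => zx; last by rewrite addr0.
  by rewrite addrC -lerBrDr; exact: (yimin (z, j)).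
exists mu'; split => //.
  by move=> z; rewrite addr_ge0//; case: ifP.
move=> z; rewrite inE => /predU1P[->|/tight[u [j [zu uj]]]].
  by exists y, i; split => //; rewrite mu'E yx /t /slack/= addrC subrK.
exists u, j; split => //; apply/eqP; rewrite eq_le mu'w -uj mu'E lerDl/=.
by case: (d u x <= _).
Qed.

(** Radii do not decrease along the list and the tail is selected first. The head ball is added if
    it misses all selected balls; otherwise it meets one at least as large, whose doubled ball
    contains the center of the head. *)
Lemma vitali_seq (s : seq (T * I)) :
  sorted (fun p q => rho p.2 <= rho q.2) s -> exists S : seq (T * I),
  [/\ {subset S <= s},
      pairwise (fun p q => [forall z,
        ~~ ((d p.1 z <= rho p.2) && (d q.1 z <= rho q.2))]) S &
      {in s, forall p, exists2 q, q \in S & d q.1 p.1 <= 2 * rho q.2 /\ rho p.2 <= rho q.2}].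
Proof.
elim: s => [|p s IH] ps; first by exists [::].
have /IH[S [Ss Sdisj Smeet]] := path_sorted ps.
have pmin : {in s, forall q, rho p.2 <= rho q.2}.
  apply/allP; apply: (order_path_min (x := p)) ps.
  by move=> ? ? ?; exact: le_trans.
have [disj|/allPn[q qS]] := boolP (all (fun q => [forall z,
    ~~ ((d p.1 z <= rho p.2) && (d q.1 z <= rho q.2))]) S).
  exists (p :: S); split.
  - move=> q; rewrite !inE => /predU1P[->|/Ss ->]; first by rewrite eqxx.
    by rewrite orbT.
  - by rewrite /= disj.
  - move=> q; rewrite inE => /predU1P[->|/Smeet[u uS uq]].
      by exists p; rewrite ?mem_head// dxx mulr_ge0.
    by exists u; rewrite // inE uS orbT.
rewrite negb_forall => /existsP[z /negPn/andP[pz qz]].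
exists S; split => //.
- by move=> u /Ss us; rewrite inE us orbT.
- move=> u; rewrite inE => /predU1P[->|/Smeet//].
  exists q => //; have pq := pmin _ (Ss _ qS); split => //.
  by apply: (le_trans (dD z _ _)); rewrite [d z _]dC; lra.
Qed.

Lemma sum_disjoint_bmass (mu : T -> R) (S : seq (T * I)) :
  (forall x, 0 <= mu x) ->
  pairwise (fun p q => [forall z,
    ~~ ((d p.1 z <= rho p.2) && (d q.1 z <= rho q.2))]) S ->
  \sum_(q <- S) bmass d mu [set: T] q.1 (rho q.2) <= \sum_x mu x.
Proof.
move=> mu0; suff H : pairwise (fun p q => [forall z,
    ~~ ((d p.1 z <= rho p.2) && (d q.1 z <= rho q.2))]) S ->
    \sum_(q <- S) bmass d mu [set: T] q.1 (rho q.2)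
    <= \sum_(x | has (fun q => d q.1 x <= rho q.2) S) mu x.
  by move=> /H /le_trans; apply; exact: (ler_sum_sub mu0).
elim: S => [|p S IH]; first by rewrite big_nil sumr_ge0.
rewrite pairwise_cons big_cons => /andP[/allP disj /IH le_sum].
rewrite (bigID (fun x => d p.1 x <= rho p.2))/= lerD//.
  apply: (ler_sum_sub mu0) => x; rewrite inE /= => px.
  by rewrite px.
apply: (le_trans le_sum); apply: (ler_sum_sub mu0) => x /hasP[q qS qx].
rewrite /=; have -> : has (fun q => d q.1 x <= rho q.2) S by apply/hasP; exists q.
by rewrite orbT/=; have /forallP/(_ x) := disj _ qS; rewrite qx andbT.
Qed.

(* A coordinatewise maximal mass subject to [mass (ball x (rho i)) <= w i] has
   every point in a ball where the constraint is an equality; a disjoint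
   Vitali subfamily of these tight balls bounds the total mass from below. *)
Lemma finite_frostman (i0 : I) : exists mu : T -> R,
  [/\ forall x, 0 <= mu x,
      forall x i, bmass d mu [set: T] x (rho i) <= w i &
      exists S : seq (T * I),
        (forall x, exists2 q, q \in S & d q.1 x <= 3 * rho q.2) /\
        \sum_(q <- S) w q.2 <= \sum_x mu x].
Proof.
have [mu [mu0 muw tight]] := exists_tight_mass i0 (enum T).
exists mu; split => //.
pose le_rho (p q : T * I) := rho p.2 <= rho q.2.
pose s := sort le_rho (enum [pred q : T * I |
  bmass d mu [set: T] q.1 (rho q.2) == w q.2]).
have [|S [Ss Sdisj Smeet]] := @vitali_seq s.
  by apply: sort_sorted => p q; exact: le_total.
exists S; split.
  move=> x; have [|y [i [yx yi]]] := tight x; first by rewrite mem_enum.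
  have [|q qS [qy yq]] := Smeet (y, i).
    by rewrite mem_sort mem_enum inE/= yi.
  (* The factor 3 is 2 + 1: [y] is within [2 * rho q.2] of [q.1], and [x] is within
     [rho i <= rho q.2] of [y]. *)
  exists q => //; apply: (le_trans (dD y _ _)); move: qy yq; rewrite /=; lra.
apply: le_trans (sum_disjoint_bmass mu0 Sdisj).
rewrite big_seq [leRHS]big_seq; apply: ler_sum => q /Ss.
by rewrite mem_sort mem_enum inE => /eqP ->.
Qed.

End finite_frostman.

Local Open Scope classical_set_scope.
Local Open Scope ring_scope.

(** * Finite consequences of the two dimensions *)

Section dimension_bounds.
Context {R : realType} (X : metricType R).

Lemma diam_ge0 (U : set X) : (0 <= diam U)%E.
Proof. by apply: ereal_sup_ubound; left. Qed.

Lemma diam_closed_mball (x : X) (r : R) :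
  0 <= r -> (diam (closed_mball x r) <= (2 * r)%:E)%E.
Proof.
move=> r0; apply: ge_ereal_sup => _ [->|[y xy [z xz <-]]].
  by rewrite lee_fin mulr_ge0.
rewrite lee_fin (le_trans (metric_triangle _ x _))// metric_sym mulr2n mulrDl mul1r.
exact: lerD.
Qed.

(** If all premeasures vanished at the exponent [s], the dimension would be at most [s]; so one of
    them, at some scale [delta], is positive. A family with [2 * q.2] above [delta] for some ball
    has sum at least [delta] to the power [s], hence the minimum. *)
Lemma hausdorff_content_gt0 (s : R) : 0 < s -> (s%:E < hausdorff_dim X)%E ->
  exists2 h : R, 0 < h & forall L : seq (X * R), {in L, forall q, 0 <= q.2} ->
    (forall x, exists2 q, q \in L & mdist q.1 x <= q.2) ->
    h <= \sum_(q <- L) (2 * q.2) `^ s.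
Proof.
move=> s0 s_dim.
have pre_ge0 delta : (0 <= hausdorff_premeasure s delta [set: X])%E.
  by apply: le_ereal_inf_tmp => _ [U _ <-]; apply: nneseries_ge0 => *; exact: poweR_ge0.
have [delta delta0 pre_gt0] :
    exists2 delta, 0 < delta & (0 < hausdorff_premeasure s delta [set: X])%E.
  apply: contrapT => pre0; move: s_dim; rewrite ltNge => /negP; apply.
  apply: ereal_inf_lbound; exists s => //=; split => //.
  apply/eqP; rewrite eq_le; apply/andP; split.
    apply: ge_ereal_sup => _ [delta delta0 <-]; rewrite leNgt; apply/negP => pre_gt0.
    by apply: pre0; exists delta.
  by apply: le_trans (pre_ge0 1) _; apply: ereal_sup_ubound; exists 1 => /=.
have [h0 h0_gt0 h0_pre] :
    exists2 h0 : R, 0 < h0 & (h0%:E <= hausdorff_premeasure s delta [set: X])%E.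
  case: (hausdorff_premeasure _ _ _) pre_gt0 => [t t0|_|//].
    by exists t.
  by exists 1 => //; rewrite leey.
exists (Num.min h0 (delta `^ s)).
  by rewrite lt_min h0_gt0 powR_gt0.
move=> L L0 L_cover; rewrite ge_min.
have [|lt_sum] := leP (delta `^ s) (\sum_(q <- L) (2 * q.2) `^ s).
  by rewrite orbT.
rewrite orbF -lee_fin; apply: (le_trans h0_pre).
(* The finite family is continued by empty sets with diameter bound [0], which add nothing as [s] is
   positive. *)
pose U := nth set0 [seq closed_mball q.1 q.2 | q <- L].
pose D := nth 0 [seq 2 * q.2 | q <- L].
have diamU i : (diam (U i) <= (D i)%:E)%E.
  rewrite /U /D; elim: (L) L0 i => [|q L' IH] L0 i.
    rewrite !nth_nil; apply: ge_ereal_sup => _ [->//|[y []]].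
  case: i => [|i] /=; first by rewrite diam_closed_mball// L0 ?mem_head.
  by apply: IH => q' q'L; rewrite L0// inE q'L orbT.
have D0 i : 0 <= D i by rewrite -lee_fin (le_trans (diam_ge0 _) (diamU i)).
have Ddelta i : D i <= delta.
  rewrite leNgt; apply/negP => deltaD.
  have [iL|Li] := ltnP i (size [seq 2 * q.2 | q <- L]); last first.
    by move: deltaD; rewrite /D nth_default// ltNge ltW.
  move: lt_sum; rewrite ltNge => /negP; apply.
  have /mapP[q qL Dq] := mem_nth 0 iL.
  apply: (@le_trans _ _ ((D i) `^ s)).
    by apply: ge0_ler_powR; rewrite ?nnegrE ?(ltW s0) ?(ltW delta0) ?D0// ltW.
  rewrite /D Dq (big_rem q)//= lerDl sumr_ge0// => *; exact: powR_ge0.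
apply: (@le_trans _ _ (\sum_(0 <= i <oo) diam (U i) `^ s)%E).
  apply: ereal_inf_lbound; exists U => //; split.
    by move=> i; rewrite (le_trans (diamU i))// lee_fin.
  move=> x _; have [q qL xq] := L_cover x.
  exists (index q L) => //; rewrite /U (nth_map q) ?index_mem//.
  by rewrite nth_index.
apply: (@le_trans _ _ (\sum_(0 <= i <oo) (D i `^ s)%:E)%E).
  apply: lee_nneseries => [i _ _|i _]; first exact: poweR_ge0.
  rewrite -poweR_EFin; apply: gt0_ler_poweR (diamU i); rewrite ?(ltW s0)//.
    by rewrite in_itv/= leey andbT diam_ge0.
  by rewrite in_itv/= leey andbT lee_fin.
rewrite (nneseries_split _ (size L)); last by move=> *; rewrite lee_fin powR_ge0.
rewrite add0n eseries0 ?adde0; last first.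
  by move=> i Li _; rewrite /D nth_default ?size_map// powR0 ?gt_eqF.
rewrite sumEFin lee_fin -[leRHS](big_map (fun q => 2 * q.2) xpredT (fun t => t `^ s)).
by rewrite [leRHS](big_nth 0) size_map.
Qed.

Lemma covering_number_ge1 (x : X) (r : R) : (1 <= covering_number X r)%E.
Proof.
apply: le_ereal_inf_tmp => _ [n [c c_cover] <-]; rewrite lee_fin ler1n lt0n.
by apply/eqP => n0; subst n; have [[]] := c_cover x Logic.I.
Qed.

Lemma upper_box_dimE (x : X) : upper_box_dim X =
  limf_esup (fun r : R => lne (covering_number X r) * ((ln r^-1)^-1)%:E)%E 0^'+.
Proof. by rewrite /upper_box_dim asboolF// => /seteqP[/(_ x Logic.I)]. Qed.

Lemma upper_box_dim_ge0 : (0 <= upper_box_dim X)%E.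
Proof.
have [[x _]|noX] := pselect ([set: X] !=set0); last first.
  rewrite /upper_box_dim asboolT//; apply/seteqP; split => // x _.
  by apply: noX; exists x.
rewrite (upper_box_dimE x); apply: le_ereal_inf_tmp => _ [V V0 <-].
have [r [r0 r1 Vr]] : exists r : R, [/\ 0 < r, r < 1 & V r].
  have P0 := @nbhs_right_gt R 0; have P1 := @nbhs_right_lt R 0 1 ltr01.
  have P01 : (0 : R)^'+ ([set r : R | 0 < r] `&` [set r : R | r < 1] `&` V).
    by apply: (filterI _ V0); apply: filterI.
  by have [r [[r0 r1] Vr]] := filter_ex P01; exists r.
apply: (@le_trans _ _ (lne (covering_number X r) * ((ln r^-1)^-1)%:E)%E); last first.
  by apply: ereal_sup_ubound; exists r.
rewrite mule_ge0// ?lne_ge0 ?(covering_number_ge1 x)//.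
by rewrite lee_fin invr_ge0 ln_ge0// invf_ge1// ltW.
Qed.

Lemma upper_box_dim_cover (x : X) (u : R) : (upper_box_dim X < u%:E)%E ->
  exists2 r0 : R, 0 < r0 & forall r, 0 < r < r0 ->
    exists n, exists2 c : 'I_n -> X,
      (forall y, exists i, mdist (c i) y <= r) & n%:R <= r `^ (- u).
Proof.
rewrite (upper_box_dimE x) => /ereal_inf_lt[_ [V V0 <-] ltu].
move: V0 => [e /= e0 eV].
(* The bound [1] makes [ln r^-1] positive, so that it can be cleared from the quotient. *)
exists (Num.min e 1) => [|r]; first by rewrite lt_min e0 ltr01.
rewrite lt_min => /and3P[r0 re r1].
have Vr : V r by apply: eV => //=; rewrite sub0r normrN gtr0_norm.
have : (lne (covering_number X r) * ((ln r^-1)^-1)%:E < u%:E)%E.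
  by apply: le_lt_trans ltu; apply: ereal_sup_ubound; exists r.
have lnr : 0 < ln r^-1 by rewrite ln_gt0// invf_gt1.
rewrite lte_pdivrMr// -EFinM => lt_lne.
have : (covering_number X r < (r `^ (- u))%:E)%E.
  rewrite -lte_lne.
  - rewrite lne_EFin ?powR_gt0// ln_powR; apply: (lt_le_trans lt_lne).
    by rewrite lee_fin lnV// mulrN mulNr.
  - by rewrite in_itv/= leey andbT (le_trans _ (covering_number_ge1 x r)).
  - by rewrite in_itv/= leey andbT lee_fin powR_ge0.
move=> /ereal_inf_lt[_ [n [c c_cover] <-]]; rewrite lte_fin => /ltW nr.
exists n, c => // y; have [i _ ciy] := c_cover y Logic.I; by exists i.
Qed.

End dimension_bounds.

(** * Limits of approximate maps and the inverse on the closure *)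

Lemma powR_ineq_lim {R : realType} (alpha C x t : R) : 0 < alpha -> 0 < C -> 0 <= t ->
  (forall e, 0 < e -> x <= C * (t + e) `^ alpha + e) -> x <= C * t `^ alpha.
Proof.
move=> alpha0 C0 t0 H; rewrite leNgt; apply/negP => lt_x.
have [y ty yx] : exists2 y, C * t `^ alpha < y & y < x.
  by exists ((C * t `^ alpha + x) / 2); lra.
have y0 : 0 < y by rewrite (le_lt_trans _ ty)// mulr_ge0 ?powR_ge0 ?ltW.
(* [q] solves C q^alpha = y. As [y] lies strictly between the two sides, [t + e] can stay at most
   [q] with [y + e] below [x]. *)
pose q := (y / C) `^ alpha^-1.
have qE : C * q `^ alpha = y.
  rewrite /q -powRrM mulVf ?gt_eqF// powRr1 ?divr_ge0 ?ltW//.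
  by rewrite mulrC divfK ?gt_eqF.
have tq : t < q.
  rewrite ltNge; apply/negP => qt; suff : y <= C * t `^ alpha by rewrite leNgt ty.
  by rewrite -[leLHS]qE ler_pM2l// ge0_ler_powR ?nnegrE ?powR_ge0 ?(ltW alpha0).
pose e := Num.min (q - t) ((x - y) / 2).
have e0 : 0 < e by rewrite lt_min subr_gt0 tq/= divr_gt0// subr_gt0.
have /lt_geF : C * (t + e) `^ alpha + e < x; last by rewrite H.
apply: (@le_lt_trans _ _ (y + e)).
  rewrite lerD2r -qE ler_pM2l// ge0_ler_powR ?nnegrE ?powR_ge0 ?addr_ge0 ?(ltW alpha0) ?(ltW e0)//.
  by rewrite -lerBrDl ge_min lexx.
have : e <= (x - y) / 2 by rewrite ge_min lexx orbT.
by lra.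
Qed.

Section expanding_maps.
Context {R : realType} (A B : metricType R) (alpha C : R).
Context (alpha0 : 0 < alpha) (C0 : 0 < C).

Lemma mdist_perturb (X : metricType R) (x x' y y' : X) (e : R) :
  mdist x x' < e -> mdist y y' < e -> mdist x y <= mdist x' y' + 2 * e.
Proof.
move=> xx' yy'; have := metric_triangle x x' y; have := metric_triangle x' y' y.
by rewrite (metric_sym y' y); lra.
Qed.

(** Tychonoff gives a cluster point [h] of the approximate maps in the product topology. Each
    inequality involves only two coordinates, so it passes to [h]. *)
Lemma expanding_limit : compact [set: A] ->
  (forall e, 0 < e -> exists g : B -> A,
    forall b b', mdist b b' <= C * mdist (g b) (g b') `^ alpha + e) ->
  exists g : B -> A, forall b b', mdist b b' <= C * mdist (g b) (g b') `^ alpha.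
Proof.
move=> cA approx.
have /choice[g gP] : forall n : nat, exists g : B -> A, forall b b',
    mdist b b' <= C * mdist (g b) (g b') `^ alpha + n.+1%:R^-1.
  by move=> n; apply: approx; rewrite invr_gt0.
have gT : (g @ \oo) [set f : B -> A | forall b, [set: A] (f b)].
  by apply: (@filterS _ _ _ setT) => //; exact: filterT.
have [h [_ clh]] := @tychonoff B (fun=> A) (fun=> [set: A]) (fun=> cA) (g @ \oo) _ gT.
exists h => b b'; apply: powR_ineq_lim => // [|e e0]; first exact: mdist_ge0.
have e20 : 0 < e / 2 by rewrite divr_gt0.
pose S := g @` [set n : nat | n.+1%:R^-1 < e].
have SP : (g @ \oo) S.
  by apply: filterS (near_infty_natSinv_lt (PosNum e0)) => n nP; exists n.
have nbh c : nbhs h (proj c @^-1` ball (h c) (e / 2)).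
  exact: (@proj_continuous B (fun=> A) c h _ (nbhsx_ballx _ _ e20)).
have [_ [[n /= ne <-]]] := clh _ _ SP (filterI (nbh b) (nbh b')).
rewrite !ballEmdist /= /proj => -[n1 n2].
apply: (le_trans (gP n b b')); apply: lerD; last exact: ltW.
rewrite ler_pM2l// ge0_ler_powR ?nnegrE ?mdist_ge0 ?(ltW alpha0)//.
  by rewrite addr_ge0 ?mdist_ge0 ?ltW.
have := @mdist_perturb _ (g n b) (h b) (g n b') (h b') (e / 2).
by rewrite metric_sym [mdist (g n b') _]metric_sym => /(_ n1 n2); lra.
Qed.

(** The closure [K] of the transposed graph of [g] satisfies the same inequality. Hence it is the
    graph of a Hölder map with compact domain, which attains every [b] since [(g b, b)] lies in
    [K]. *)
Lemma holder_onto_of_expanding (g : B -> A) :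
  compact [set: A] -> compact [set: B] ->
  (forall b b', mdist b b' <= C * mdist (g b) (g b') `^ alpha) ->
  exists (A' : set A) (f : set_type A' -> B),
    [/\ compact A', holder alpha f & range f = [set: B]].
Proof.
move=> cA cB gP; pose K : set (A * B) := closure (range (fun b => (g b, b))).
have KP a b a' b' : K (a, b) -> K (a', b') -> mdist b b' <= C * mdist a a' `^ alpha.
  move=> Kab Kab'; apply: powR_ineq_lim => // [|e e0]; first exact: mdist_ge0.
  have e20 : 0 < e / 2 by rewrite divr_gt0.
  have [_ [[u _ <-] /= []]] := Kab _ (nbhsx_ballx (a, b) _ e20).
  have [_ [[u' _ <-] /= []]] := Kab' _ (nbhsx_ballx (a', b') _ e20).
  rewrite !ballEmdist /= => au' bu' au bu.
  have := mdist_perturb bu bu'; have := gP u u'.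
  have gu : mdist (g u) (g u') <= mdist a a' + e.
    have := @mdist_perturb _ (g u) a (g u') a' (e / 2).
    by rewrite metric_sym [mdist (g u') _]metric_sym => /(_ au au'); lra.
  have : C * mdist (g u) (g u') `^ alpha <= C * (mdist a a' + e) `^ alpha.
    rewrite ler_pM2l// ge0_ler_powR ?nnegrE ?mdist_ge0 ?(ltW alpha0)//.
    by rewrite addr_ge0 ?mdist_ge0 ?ltW.
  by lra.
have cK : compact K.
  apply: (@subclosed_compact _ _ ([set: A] `*` [set: B])).
  - exact: closed_closure.
  - exact: compact_setX.
  - by [].
pose A' := fst @` K.
have /choice[f fP] : forall a : set_type A', exists b, K (set_val a, b).
  move=> a; have [[a0 b] Kab ab] := set_valP a; by exists b; rewrite set_valE -ab.
exists A', f; split.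
- apply: continuous_compact cK; apply: continuous_subspaceT => x; exact: cvg_fst.
- by exists C => x z; apply: KP; exact: fP.
- apply/seteqP; split => // b _.
  have Kgb : K (g b, b) by apply: subset_closure; exists b.
  have gbA' : A' (g b) by exists (g b, b).
  exists (exist _ (g b) (mem_set gbA')) => //.
  have := KP _ _ _ _ (fP (exist _ (g b) (mem_set gbA'))) Kgb.
  rewrite /= mdistxx powR0 ?gt_eqF// mulr0 => h.
  by apply/mdist_positivity/eqP; rewrite eq_le h mdist_ge0.
Qed.

End expanding_maps.

(** * Discretizing both spaces *)

Lemma compact_net {R : realType} (A : metricType R) (delta : R) :
  compact [set: A] -> 0 < delta ->
  exists L : seq A, forall x, exists2 y, y \in L & mdist y x <= delta.
Proof.
move=> /compact_near_coveringP cA delta0.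
(* Finite lists ordered by inclusion give a filter along which each point is eventually covered
   together with a neighbourhood. *)
pose F : set_system (seq A) :=
  filter_from setT (fun L0 : seq A => [set L : seq A | {subset L0 <= L}]).
have FF : Filter F.
  apply: filter_from_filter; first by exists [::].
  move=> L1 L2 _ _; exists (L1 ++ L2) => // L sL.
  by split => y yL; apply: sL; rewrite mem_cat yL ?orbT.
have [|L _ LP] := cA _ F (fun L x => exists2 y, y \in L & mdist y x <= delta) FF.
  move=> x _; exists (ball x delta, [set L : seq A | {subset [:: x] <= L}]).
    by split; [exact: nbhsx_ballx|exists [:: x]].
  move=> [y L] /= [+ xL]; rewrite ballEmdist => xy.
  by exists x; [apply: xL; rewrite mem_head|exact: ltW].
by exists L => x; exact: (LP L).
Qed.

(** On a net of mesh [r J.+1], a finite Frostman mass turns the lower bound [h] on covering sums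
    into a total mass of at least h / 14^s, whatever [J] is. This supplies the capacity required at
    the root. *)
Lemma metric_tree_embedding {R : realType} (A : metricType R) (s h : R)
    (K J : nat) (r : nat -> R) (I : nat -> finType) (p : forall n, I n.+1 -> I n)
    (B : Type) (l : forall n, B -> I n) (i0 : I 0%N) :
  let eps : R := K.+1%:R^-1 in
  compact [set: A] -> 0 < s -> 0 < h ->
  (forall L : seq (A * R), {in L, forall q, 0 <= q.2} ->
    (forall x, exists2 q, q \in L & mdist q.1 x <= q.2) ->
    h <= \sum_(q <- L) (2 * q.2) `^ s) ->
  (forall m, 0 < r m) -> (forall m, r m = 4 * r m.+1) ->
  (forall m b, (m <= J)%N -> p m (l m.+1 b) = l m b) ->
  (forall b, l 0%N b = i0) ->
  \sum_(1 <= m < J.+2) #|I m|%:R * (r m `^ s) `^ (1 - eps) <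
    (h / 14 `^ s) `^ (1 - eps) ->
  exists g : B -> A, forall b b' m, (0 < m <= J.+1)%N -> l m b <> l m b' ->
    r m / K.+1%:R < mdist (g b) (g b').
Proof.
move=> eps cA s0 h0 content r0 rS lp li0 sum_lt.
have eps0 : 0 < eps by rewrite invr_gt0.
have eps1 : eps <= 1 by rewrite invf_le1// ler1n.
have r_le m n : (m <= n)%N -> r n <= r m.
  move/subnKC <-; elim: (n - m)%N => [|k IH]; first by rewrite addn0.
  by rewrite addnS; apply: le_trans IH; have := r0 (m + k).+1; rewrite [leRHS]rS; lra.
have [L L_net] := compact_net cA (r0 J.+1).
pose x (i : 'I_(size L)) := tnth (in_tuple L) i.
pose d i j := mdist (x i) (x j).
have dxx i : d i i = 0 by exact: mdistxx.
have dC i j : d i j = d j i by exact: metric_sym.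
have dD j i k : d i k <= d i j + d j k by exact: metric_triangle.
have net a : exists i, mdist (x i) a <= r J.+1.
  have [y yL ya] := L_net a; have /(tnthP (in_tuple L))[i yi] := yL.
  by exists i; rewrite /x -yi.
(* Index [i] stands for level [i.+1]: the constraints concern levels 1 to [J.+1], with the radii
   [2 * r m] at which carving needs mass bounds. *)
pose rho (i : 'I_J.+1) := 2 * r i.+1.
have rho0 i : 0 <= rho i by rewrite mulr_ge0// ltW.
have w0 (i : 'I_J.+1) : 0 <= r i.+1 `^ s by exact: powR_ge0.
have [mu [mu0 mu_le [S [S_cover S_sum]]]] :=
  finite_frostman dxx dC dD rho0 w0 ord0.
have mass_ge : h / 14 `^ s <= \sum_i mu i.
  rewrite ler_pdivrMr ?powR_gt0//.
  apply: le_trans (_ : (\sum_(q <- S) r (nat_of_ord q.2).+1 `^ s) * 14 `^ s <= _); last first.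
    by rewrite ler_pM2r ?powR_gt0.
  (* In the radius, 7 is 3 * 2 from the Vitali enlargement plus 1 for the distance to the net;
     doubling gives the 14. *)
  have := content [seq (x q.1, 7 * r (nat_of_ord q.2).+1) | q <- S].
  rewrite big_map mulr_suml => /(_ _ _)/le_trans; apply.
  - by move=> _ /mapP[q _ ->]/=; rewrite mulr_ge0// ltW.
  - move=> a; have [i ia] := net a; have [q qS qi] := S_cover i.
    exists (x q.1, 7 * r q.2.+1); first by apply/mapP; exists q.
    rewrite /= (le_trans (metric_triangle _ (x i) _))//.
    have := r_le q.2.+1 J.+1 (ltn_ord q.2); move: qi ia; rewrite /rho /d; lra.
  - apply: ler_sum => q _ /=; rewrite mulrA mulrC -natrM powRM// ltW//.
have M0 : 0 < \sum_i mu i by rewrite (lt_le_trans _ mass_ge)// divr_gt0 ?powR_gt0.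
have [|||g [_ gP]] := @tree_embedding R _ d mu dxx dC dD mu0 I p B l r
    (fun m => r m `^ s) K J.+1 0 i0 [:: [set: _]%SET] r0 rS.
- move=> m; rewrite add0n => /andP[_ mJ]; split; last by move=> b; exact: lp.
  by move=> i; exact: (mu_le i (Ordinal mJ)).
- by [].
- rewrite big_seq1; apply: (@lt_le_trans _ _ ((\sum_i mu i) `^ (1 - eps))).
    apply: lt_le_trans (_ : (h / 14 `^ s) `^ (1 - eps) <= _); last first.
      by rewrite ge0_ler_powR ?subr_ge0 ?nnegrE ?divr_ge0 ?powR_ge0// ltW.
    apply: le_lt_trans sum_lt; rewrite -(sum_demand p) (bigD1 i0)//= lerDl.
    by apply: sumr_ge0 => i _; apply: (@demand_ge0 _ I p _ J.+1 0) => m; exact: powR_ge0.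
  by rewrite energy_setT_ge ?ltW.
exists (x \o g) => b b' m /andP[m0 mJ] lbb'.
by apply: gP => //; rewrite m0.
Qed.

(** Rounding through all finer levels up to [J], rather than each point directly, makes the label at
    level [m] a function of the label at level [m.+1]. The errors form a geometric series bounded by
    [rho m / (1 - theta)]. *)
Lemma rounding_tree {R : realType} (B : metricType R) (N : nat -> nat)
    (c : forall m, 'I_(N m) -> B) (rho : nat -> R) (theta : R) (J : nat) :
  (forall m b, exists i, mdist (c m i) b <= rho m) ->
  (forall m, rho m.+1 = theta * rho m) -> theta < 1 ->
  exists (p : forall m, 'I_(N m.+1) -> 'I_(N m)) (l : forall m, B -> 'I_(N m)),
    (forall m b, (m < J)%N -> p m (l m.+1 b) = l m b) /\
    (forall m b b', (m <= J)%N -> l m b = l m b' ->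
      mdist b b' <= 2 / (1 - theta) * rho m).
Proof.
move=> c_cover rhoS theta1.
have rd m : exists i : B -> 'I_(N m), forall b, mdist (c m (i b)) b <= rho m.
  by have /choice[i iP] := c_cover m; exists i.
pose i m := sval (cid (rd m)).
have iP m b : mdist (c m (i m b)) b <= rho m := svalP (cid (rd m)) b.
(* [z k m b] rounds [b] successively at the levels [m + k], ..., [m + 1]. *)
pose z := fix z (k m : nat) (b : B) : B :=
  if k is k'.+1 then c m.+1 (i m.+1 (z k' m.+1 b)) else b.
have theta10 : 0 < 1 - theta by rewrite subr_gt0.
have zP k m b : mdist (z k m b) b <= theta / (1 - theta) * rho m.
  elim: k m => [|k IH] m /=.
    have : 0 <= rho m.+1 by rewrite (le_trans _ (iP m.+1 b))// mdist_ge0.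
    by rewrite mdistxx mulrAC rhoS => ?; rewrite divr_ge0// ltW.
  apply: le_trans (metric_triangle _ (z k m.+1 b) _) _.
  apply: le_trans (lerD (iP _ _) (IH _)) _; rewrite rhoS.
  by rewrite le_eqVlt; apply/orP; left; apply/eqP; field; rewrite gt_eqF.
exists (fun m j => i m (c m.+1 j)), (fun m b => i m (z (J - m)%N m b)); split.
  by move=> m b mJ; rewrite -(subnSK mJ).
move=> m b b' mJ e.
have near_b a : mdist (c m (i m (z (J - m)%N m a))) a <= (1 - theta)^-1 * rho m.
  apply: le_trans (metric_triangle _ (z (J - m)%N m a) _) _.
  apply: le_trans (lerD (iP _ _) (zP _ _ _)) _.
  by rewrite le_eqVlt; apply/orP; left; apply/eqP; field; rewrite gt_eqF.
apply: le_trans (metric_triangle _ (c m (i m (z (J - m)%N m b))) _) _.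
rewrite metric_sym -mulrA mulr2n mulrDl mul1r lerD// e.
exact: near_b.
Qed.

(** * Choice of scales and constants *)

Lemma sum_expr_le {R : realType} (q : R) (m n : nat) : 0 <= q -> q < 1 ->
  \sum_(m <= i < n) q ^+ i <= (1 - q)^-1.
Proof.
move=> q0 q1; apply: le_trans (_ : \sum_(0 <= i < n) q ^+ i <= _).
  have [mn|nm] := leqP m n; last first.
    by rewrite big_geq ?(ltnW nm)// sumr_ge0// => i _; exact: exprn_ge0.
  by rewrite [leRHS](@big_cat_nat _ _ _ m)//= lerDr sumr_ge0// => i _; exact: exprn_ge0.
suff -> : \sum_(0 <= i < n) q ^+ i = (1 - q ^+ n) / (1 - q).
  by rewrite ler_piMl ?invr_ge0 ?subr_ge0 ?(ltW q1)// gerBl exprn_ge0.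
elim: n => [|n IH]; first by rewrite big_geq// expr0 subrr mul0r.
rewrite big_nat_recr//= IH exprS; field.
by rewrite subr_eq0 gt_eqF.
Qed.

Lemma exists_powR_lt {R : realType} (x a : R) : 0 < x -> 0 < a ->
  exists2 e, 0 < e & forall t, 0 < t <= e -> t `^ x < a.
Proof.
move=> x0 a0; exists ((a / 2) `^ x^-1); first by rewrite powR_gt0 ?divr_gt0.
move=> t /andP[t0 te]; apply: (@le_lt_trans _ _ (a / 2)); last by lra.
apply: (@le_trans _ _ (((a / 2) `^ x^-1) `^ x)).
  by rewrite ge0_ler_powR ?nnegrE ?powR_ge0 ?(ltW x0) ?(ltW t0).
by rewrite -powRrM mulVf ?gt_eqF// powRr1// divr_ge0// ltW.
Qed.

(** The error [e] enters only through the depth [J] of the tree. Points of [B] whose labels first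
    differ at level [m.+1] are within a fixed multiple of r_m^alpha, while their images are more
    than [r m.+1 / K.+1] apart. *)
Lemma expanding_approximation {R : realType} (A B : metricType R)
    (alpha s u h r0 : R) (b0 : B) :
  compact [set: A] -> 0 < alpha -> 0 < s -> alpha * u < s -> 0 < u -> 0 < h ->
  (forall L : seq (A * R), {in L, forall q, 0 <= q.2} ->
    (forall x, exists2 q, q \in L & mdist q.1 x <= q.2) ->
    h <= \sum_(q <- L) (2 * q.2) `^ s) ->
  0 < r0 ->
  (forall r, 0 < r < r0 -> exists n, exists2 c : 'I_n -> B,
    (forall y, exists i, mdist (c i) y <= r) & n%:R <= r `^ (- u)) ->
  exists2 C : R, 0 < C & forall e, 0 < e -> exists g : B -> A,
    forall b b', mdist b b' <= C * mdist (g b) (g b') `^ alpha + e.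
Proof.
move=> cA alpha0 s0 au u0 h0 content r00 box.
have [K Ks] : exists K : nat, alpha * u < s * (1 - K.+1%:R^-1).
  have sau : 0 < (s - alpha * u) / s by rewrite divr_gt0// subr_gt0.
  have [K KP] := filter_ex (near_infty_natSinv_lt (PosNum sau)).
  exists K; move: KP; rewrite /= ltr_pdivlMr//; set k := _^-1; lra.
set eps : R := K.+1%:R^-1 in Ks.
pose eta := s * (1 - eps) - alpha * u.
have eta0 : 0 < eta by rewrite subr_gt0.
pose c1 := (h / 14 `^ s) `^ (1 - eps).
have c10 : 0 < c1 by rewrite powR_gt0// divr_gt0// powR_gt0.
have q_bounds x : 0 < x -> 0 <= (4^-1 : R) `^ x < 1.
  move=> x0; rewrite powR_ge0/=; have := @gt0_ltr_powR R x x0 4^-1 1.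
  by rewrite powR1; apply; rewrite ?nnegrE; lra.
pose theta : R := 4^-1 `^ alpha.
have /andP[theta0 theta1] : 0 <= theta < 1 by exact: q_bounds.
pose q : R := 4^-1 `^ eta.
have /andP[q0 q1] : 0 <= q < 1 by exact: q_bounds.
have [e1 e10 e1P] := exists_powR_lt alpha0 r00.
have [e2 e20 e2P] : exists2 e, 0 < e & forall t, 0 < t <= e -> t `^ eta < c1 * (1 - q).
  by apply: exists_powR_lt; rewrite // mulr_gt0// subr_gt0.
(* [e1] brings all radii r_m^alpha below [r0]; [e2] makes the total demand smaller than the capacity
   [c1]. *)
pose ep := Num.min e1 e2.
have ep0 : 0 < ep by rewrite lt_min e10 e20.
pose r (m : nat) := ep * 4^-1 ^+ m.
have r_gt0 m : 0 < r m by rewrite mulr_gt0// exprn_gt0.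
have rS m : r m = 4 * r m.+1.
  by rewrite /r exprS; set v := _ ^+ m; field.
have r_powR m x : r m `^ x = ep `^ x * (4^-1 `^ x) ^+ m.
  rewrite /r powRM ?(ltW ep0) ?exprn_ge0//; congr (_ * _).
  elim: m => [|m IH]; first by rewrite !expr0 powR1.
  by rewrite !exprS powRM ?exprn_ge0// IH.
have r_lt m : r m `^ alpha < r0.
  apply: e1P; rewrite r_gt0/= /r (@le_trans _ _ ep)//; last by rewrite ge_min lexx.
  by rewrite ler_piMr ?(ltW ep0)// exprn_ile1//; lra.
(* [D] lets a single ball around [b0] cover [B] at level 0, so the tree has one root. Multiplying
   every radius by it keeps them geometric, and [1 <= D] keeps the finer covers valid. *)
have [D [D1 DP]] : exists D : R, 1 <= D /\ forall b, mdist b0 b <= D * r 0%N `^ alpha.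
  have [|n [c c_cover _]] := box (r 0%N `^ alpha).
    by rewrite powR_gt0//= r_lt.
  have ra0 : 0 < r 0%N `^ alpha by rewrite powR_gt0.
  exists (1 + \sum_i mdist b0 (c i) / r 0%N `^ alpha); split.
    by rewrite lerDl sumr_ge0// => i _; rewrite divr_ge0 ?mdist_ge0 ?ltW.
  move=> b; have [i ib] := c_cover b.
  apply: le_trans (metric_triangle _ (c i) _) _.
  rewrite mulrDl mul1r addrC lerD// mulr_suml (bigD1 i)//= divfK ?gt_eqF// lerDl.
  by rewrite sumr_ge0// => j _; rewrite divfK ?gt_eqF// mdist_ge0.
have D0 : 0 < D := lt_le_trans ltr01 D1.
pose rho m := D * r m `^ alpha.
have rhoS m : rho m.+1 = theta * rho m.
  by rewrite /rho !r_powR exprS /theta; ring.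
have rho_ge m : r m `^ alpha <= rho m.
  by rewrite ler_peMl// powR_ge0.
have /(_ _)/cid levels m : exists Nc : {n & 'I_n -> B},
    [/\ forall b, exists i, mdist (projT2 Nc i) b <= rho m,
        m = 0%N -> projT1 Nc = 1%N &
        (0 < m)%N -> (projT1 Nc)%:R <= (r m `^ alpha) `^ (- u)].
  case: m => [|m].
    by exists (existT _ 1%N (fun=> b0)); split => // b; exists ord0; exact: DP.
  have [|n [c c_cover nP]] := box (r m.+1 `^ alpha).
    by rewrite powR_gt0//= r_lt.
  exists (existT _ n c); split => //= b; have [i ib] := c_cover b.
  by exists i; rewrite (le_trans ib).
pose N m := projT1 (sval (levels m)).
pose c m : 'I_(N m) -> B := projT2 (sval (levels m)).
have c_cover m b : exists i, mdist (c m i) b <= rho m.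
  by have [+ _ _] := svalP (levels m); exact.
have N0 : N 0%N = 1%N by have [_ + _] := svalP (levels 0%N); exact.
have N_le m : (0 < m)%N -> (N m)%:R <= (r m `^ alpha) `^ (- u).
  by have [_ _ +] := svalP (levels m); exact.
(* Level [m] has at most r_m^(-alpha u) nodes, so each term is at most r_m^eta = ep^eta q^m. *)
have sum_lt J : \sum_(1 <= m < J.+2) #|'I_(N m)|%:R * (r m `^ s) `^ (1 - eps) < c1.
  apply: (@le_lt_trans _ _ (\sum_(1 <= m < J.+2) ep `^ eta * q ^+ m)).
    rewrite big_nat_cond [leRHS]big_nat_cond; apply: ler_sum => m /andP[/andP[m0 _] _].
    rewrite card_ord -r_powR -!powRrM.
    apply: le_trans (ler_wpM2r (powR_ge0 _ _) (N_le _ m0)) _.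
    rewrite -!powRrM -powRD; last by rewrite (gt_eqF (r_gt0 m)) implybT.
    by rewrite mulrN addrC.
  rewrite -mulr_sumr; apply: (@le_lt_trans _ _ (ep `^ eta * (1 - q)^-1)).
    by rewrite ler_wpM2l ?powR_ge0// sum_expr_le.
  rewrite ltr_pdivrMr ?subr_gt0// e2P// ep0/=.
  by rewrite ge_min lexx orbT.
have [M M0 ME] : exists2 M : R, 0 < M & 2 / (1 - theta) = M.
  by exists (2 / (1 - theta)); rewrite // divr_gt0// subr_gt0.
(* Since r_m = 4 r_(m+1), this constant times (r_(m+1) / K.+1)^alpha is exactly [M * rho m]. *)
exists (M * D * (4 * K.+1%:R) `^ alpha).
  by rewrite !(mulr_gt0, powR_gt0).
move=> e e0.
(* At depth [J.+1], points with equal labels are within [e]. *)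
have [J JP] : exists J, M * rho J.+1 <= e.
  have : geometric (M * rho 0%N) theta @ \oo --> 0.
    by apply: cvg_geometric; rewrite ger0_norm.
  move=> /cvgr0Pnorm_lt /(_ e e0)[J _ JP]; exists J.
  have := JP J.+1 (leqnSn J); rewrite /= ger0_norm; last first.
    by rewrite !mulr_ge0 ?exprn_ge0 ?powR_ge0 ?(ltW M0) ?(ltW D0).
  suff -> : rho J.+1 = rho 0%N * theta ^+ J.+1 by rewrite mulrA => /ltW.
  elim: (J.+1) => [|n IH]; first by rewrite expr0 mulr1.
  by rewrite rhoS IH exprS; ring.
have [p [l [lp l_eq]]] := rounding_tree J.+1 c_cover rhoS theta1.
rewrite ME in l_eq.
have l0 b : l 0%N b = l 0%N b0.
  by apply/val_inj; move: (l 0%N b) (l 0%N b0); rewrite N0 => i j; rewrite !ord1.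
have [g gP] := @metric_tree_embedding R A s h K J r (fun m => 'I_(N m)) p B l _
  cA s0 h0 content r_gt0 rS lp l0 (sum_lt J).
exists g => b b'.
have [e_bb'|ne_bb'] := eqVneq (l J.+1 b) (l J.+1 b').
  apply: le_trans (l_eq _ _ _ (leqnn _) e_bb') _; apply: (le_trans JP).
  by rewrite lerDr !mulr_ge0 ?powR_ge0 ?(ltW M0) ?(ltW D0).
have ex_ne : exists m, l m b != l m b' by exists J.+1.
case: (ex_minnP ex_ne) => -[|m] ne_m min_m; first by rewrite l0 (l0 b') eqxx in ne_m.
have mJ : (m.+1 <= J.+1)%N by exact: min_m.
have e_m : l m b = l m b'.
  by apply/eqP; apply: contraT => /min_m; rewrite ltnn.
apply: le_trans (l_eq _ _ _ (ltnW mJ) e_m) _.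
have K40 : 0 <= 4 * K.+1%:R :> R by rewrite mulr_ge0.
have rK0 : 0 <= r m.+1 / K.+1%:R by rewrite divr_ge0// ltW.
apply: (@le_trans _ _ (M * D * (4 * K.+1%:R) `^ alpha *
  (r m.+1 / K.+1%:R) `^ alpha)).
  rewrite -[in leRHS]mulrA -(powRM _ K40 rK0).
  rewrite /rho mulrA rS le_eqVlt; apply/orP; left; apply/eqP.
  by congr (_ * _ `^ _); field.
have := gP b b' m.+1; rewrite mJ => /(_ isT (elimN eqP ne_m)) => lt_g.
rewrite ler_wpDr// ?(ltW e0)// ler_wpM2l//.
  by rewrite !mulr_ge0 ?powR_ge0 ?(ltW M0) ?(ltW D0).
by rewrite ge0_ler_powR ?nnegrE ?mdist_ge0 ?rK0 ?(ltW alpha0) ?(ltW lt_g).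
Qed.

(** * From the dimension inequality to the exponents *)

Lemma lte_between {R : realType} (a : R) (x : \bar R) : (a%:E < x)%E ->
  exists2 s, a < s & (s%:E < x)%E.
Proof.
case: x => [y| |//]; last by exists (a + 1); rewrite ?ltry//; lra.
by rewrite lte_fin => ay; exists ((a + y) / 2); rewrite ?lte_fin; lra.
Qed.

Theorem theorem4p3 (R : realType) (A B : metricType R)
    (cA : compact [set: A]) (cB : compact [set: B])
    (alpha : R) (alpha_gt0 : 0 < alpha)
    (dimAB : (alpha%:E * upper_box_dim B < hausdorff_dim A)%E) :
  exists (A' : set A) (f : set_type A' -> B),
    [/\ compact A', holder alpha f & range f = [set: B]].
Proof.
have [[b0 _]|noB] := pselect ([set: B] !=set0); last first.
  have no0 (x : set_type (set0 : set A)) : False := set_valP x.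
  exists set0, (fun x => False_rect B (no0 x)); split; first exact: compact0.
    by exists 0 => x; case: (no0 x).
  by apply/seteqP; split => // b _; exfalso; apply: noB; exists b.
(* An infinite box dimension would make the left side of [dimAB] infinite, as [alpha] is
   positive. *)
have [t t0 tE] : exists2 t : R, 0 <= t & upper_box_dim B = t%:E.
  move: (upper_box_dim_ge0 B) dimAB; case: (upper_box_dim B) => [t t0 _|_|//].
    by exists t.
  by rewrite gt0_muley ?lte_fin// ltNge leey.
rewrite tE -EFinM in dimAB; have [s ts s_dim] := lte_between dimAB.
have s0 : 0 < s by rewrite (le_lt_trans _ ts)// mulr_ge0// ltW.
(* The midpoint gives both [t < u] and [alpha * u < s]. *)
pose u := (t + s / alpha) / 2.
have t_lt : t < s / alpha by rewrite ltr_pdivlMr// mulrC.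
have tu : t < u by rewrite /u; lra.
have us : alpha * u < s by rewrite mulrC -ltr_pdivlMr// /u; lra.
have [h h0 content] := hausdorff_content_gt0 s0 s_dim.
have [|r0 r00 box] := @upper_box_dim_cover _ B b0 u; first by rewrite tE lte_fin.
have [C C0 approx] := expanding_approximation b0 cA alpha_gt0 s0 us
  (le_lt_trans t0 tu) h0 content r00 box.
have [g gP] := expanding_limit alpha_gt0 C0 cA approx.
exact (holder_onto_of_expanding alpha_gt0 C0 cA cB gP).
Qed.
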